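(* Let $L>0$ be an integer, let $y>1$ be an odd integer, and let $x$ be an integer with $1<x\le y+2$. Define the integers $a(L,y,n,x)$, $n\ge1$, by \[ \frac{1}{(q,q^{x},q^{2y};q^{2y+2})_L} - \frac{1}{(q^2,q^{y},q^{2y+1};q^{2y+2})_L} = \sum_{n=1}^\infty a(L,y,n,x)\, q^{n}. \] Then $a(L,y,n,x)\ge 0$ for all $n\ge1$. Furthermore, $a(L,y,n,x)=0$ if and only if one of the following holds: (1) $n<x$ and $n$ is even; (2) $n=y$ and $y<x$; (3) $(L,y,n,x)=(1,3,9,5)$.
   Context: For an integer $L\ge 0$, $(a;q)_L=1$ if $L=0$ and $(a;q)_L=\prod_{j=0}^{L-1}(1-aq^j)$ if $L>0$; and $(a_1,\dots,a_k;q)_L=(a_1;q)_L\cdots(a_k;q)_L$. Equivalently, $a(L,y,n,x)=P_1'(L,y,n,x)-P_2(L,y,n)$, where $P_1'(L,y,n,x)$ is the number of partitions of $n$ into parts congruent to $1$, $x$, or $2y \pmod{2y+2}$ with largest part at most $(2y+2)L-2$, and $P_2(L,y,n)$ is the number of partitions of $n$ into parts congruent to $2$, $y$, or $2y+1 \pmod{2y+2}$ with largest part at most $(2y+2)L-1$. *)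

(* Defs.v *)
From mathcomp Require Import all_boot all_order all_algebra.
Set Implicit Arguments. Unset Strict Implicit. Unset Printing Implicit Defensive.
Import Order.TTheory GRing.Theory Num.Theory.
Local Open Scope ring_scope.

Definition fps := nat -> int.

Definition fps_mul (f g : fps) : fps :=
  fun n => \sum_(i < n.+1) f i * g (n - i)%N.

Definition fps_one : fps := fun n => (n == 0%N)%:R.

(* The power series 1/(1 - q^a) = sum_k q^(a k), for a > 0. *)
Definition inv_one_minus (a : nat) : fps :=
  fun n => (a %| n)%N%:R.

Definition inv_qpoch (a m L : nat) : fps :=
  foldr fps_mul fps_one [seq inv_one_minus (a + m * j)%N | j <- iota 0 L].

Definition inv_qpochs (s : seq nat) (m L : nat) : fps :=
  foldr fps_mul fps_one [seq inv_qpoch a m L | a <- s].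

Definition acoef (L y n x : nat) : int :=
  inv_qpochs [:: 1%N; x; (2 * y)%N] (2 * y + 2) L n
  - inv_qpochs [:: 2%N; y; (2 * y + 1)%N] (2 * y + 2) L n.

(* Main.v *)
(** Write [m = 2y + 2], [P_a = 1/(1 - q^a)], and let A, B be the two products.
    Enlarging [x] by one changes [A_x - A_{x+1}] by at least [q^x P_x P_{x+1}],
    so everything reduces to [x = y + 2], where the parts of A and B in each
    residue triple have the same sum: [1 + (y+2) + 2y = 2 + y + (2y+1)].
    If [a + b = c + d] then
    [P_a P_b - P_c P_d = q^a (1 - q^{c-a}) (1 - q^{d-a}) P_a P_b P_c P_d],
    which is nonnegative once factors absorbing [1 - q^{c-a}] and [1 - q^{d-a}]
    are available.

    For [L = 1] the difference is explicit.  For [L >= 2], B is turned into A by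
    nonnegative moves: first [{2, y, 2y+1, y+m} -> {1, y+2, 2y, y+2+m}], which
    makes [P_1 P_{y+2} P_{2y}] available; then, for [1 <= j <= L-2], the shifted
    triples
    [{2+mj, 2y+1+mj, y+m(j+1)} -> {1+mj, 2y+mj, y+2+m(j+1)}]; and finally the
    unpaired [2 + m(L-1)] and [2y+1 + m(L-1)] each drop by one, using [P_1].
    Strict positivity is read off from the first move. *)
Require Import Defs.
From HB Require Import structures.
From mathcomp Require Import all_boot all_order all_algebra.
From mathcomp Require Import boolp.
From mathcomp Require Import ring zify.
Import Order.TTheory GRing.Theory Num.Theory.
Local Open Scope ring_scope.

(** * Ring structure on power series, transferred from polynomials *)

Definition trunc (N : nat) (f : fps) : {poly int} := \poly_(i < N.+1) f i.

(** Only coefficients of index at most n enter, so associativity and commutativity can be borrowed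
    from [{poly int}]. *)
Lemma fps_mul_trunc (f g : fps) (N n : nat) : (n <= N)%N ->
  fps_mul f g n = (trunc N f * trunc N g)`_n.
Proof.
move=> le_nN; rewrite coefM; apply: eq_bigr => i _.
have := ltn_ord i; rewrite ltnS => le_in.
rewrite !coef_poly !ltnS (leq_trans le_in le_nN).
by rewrite (leq_trans (leq_subr i n) le_nN).
Qed.

Lemma coef_trunc (f : fps) (N n : nat) : (n <= N)%N -> (trunc N f)`_n = f n.
Proof. by move=> le_nN; rewrite coef_poly ltnS le_nN. Qed.

Lemma fps_mulA : associative fps_mul.
Proof.
move=> f g h; apply/funext => n.
rewrite !(fps_mul_trunc _ _ n n) //.
transitivity ((trunc n f * (trunc n g * trunc n h))`_n).
  rewrite !coefM; apply: eq_bigr => i _; congr (_ * _).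
  by rewrite coef_trunc ?leq_subr // (fps_mul_trunc _ _ n) ?leq_subr.
rewrite mulrA !coefM; apply: eq_bigr => i _; congr (_ * _).
have le_in : (i <= n)%N by rewrite -ltnS ltn_ord.
by rewrite coef_trunc // (fps_mul_trunc _ _ n).
Qed.

Lemma fps_mulC : commutative fps_mul.
Proof.
by move=> f g; apply/funext => n; rewrite !(fps_mul_trunc _ _ n n) // mulrC.
Qed.

Lemma fps_mul1 : left_id fps_one fps_mul.
Proof.
move=> f; apply/funext => n; rewrite /fps_mul big_ord_recl big1 ?addr0 /=.
  by rewrite mul1r subn0.
by move=> i _; rewrite mul0r.
Qed.

HB.instance Definition _ := gen_eqMixin fps.
HB.instance Definition _ := gen_choiceMixin fps.

Definition fps_zero : fps := fun=> 0.
Definition fps_opp (f : fps) : fps := fun n => - f n.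
Definition fps_add (f g : fps) : fps := fun n => f n + g n.

Lemma fps_addA : associative fps_add.
Proof. by move=> f g h; apply/funext => n; rewrite /fps_add addrA. Qed.
Lemma fps_addC : commutative fps_add.
Proof. by move=> f g; apply/funext => n; rewrite /fps_add addrC. Qed.
Lemma fps_add0 : left_id fps_zero fps_add.
Proof. by move=> f; apply/funext => n; rewrite /fps_add add0r. Qed.
Lemma fps_addN : left_inverse fps_zero fps_opp fps_add.
Proof. by move=> f; apply/funext => n; rewrite /fps_add addNr. Qed.

HB.instance Definition _ :=
  GRing.isZmodule.Build fps fps_addA fps_addC fps_add0 fps_addN.

Lemma fps_mulDl : left_distributive fps_mul +%R.
Proof.
move=> f g h; apply/funext => n.
rewrite -[RHS]/(fps_mul f h n + fps_mul g h n) -big_split.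
by apply: eq_bigr => i _; rewrite -[(f + g) i]/(f i + g i) mulrDl.
Qed.

Lemma fps_one_neq0 : fps_one != 0 :> fps.
Proof. by apply/eqP => /(congr1 (fun f : fps => f 0%N)). Qed.

HB.instance Definition _ := GRing.Zmodule_isComNzRing.Build fps
  fps_mulA fps_mulC fps_mul1 fps_mulDl fps_one_neq0.

(** * The variable q and the geometric series *)

Notation geom := inv_one_minus.

Definition q : fps := fun n => (n == 1)%N%:R.

Lemma fpsD (f g : fps) n : (f + g) n = f n + g n. Proof. by []. Qed.
Lemma fpsB (f g : fps) n : (f - g) n = f n - g n. Proof. by []. Qed.
Lemma fpsM (f g : fps) n : (f * g) n = \sum_(i < n.+1) f i * g (n - i)%N.
Proof. by []. Qed.
Lemma fps1 n : (1 : fps) n = (n == 0)%N%:R. Proof. by []. Qed.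

Lemma coef_qM (f : fps) n : (q * f) n = if n is n'.+1 then f n' else 0.
Proof.
rewrite fpsM; case: n => [|n]; first by rewrite big_ord1 mul0r.
rewrite big_ord_recl mul0r add0r big_ord_recl big1 ?addr0 => [|i _].
  by rewrite mul1r /= subSS subn0.
by rewrite mul0r.
Qed.

Lemma coef_qXM k (f : fps) n :
  (q ^+ k * f) n = if (k <= n)%N then f (n - k)%N else 0.
Proof.
elim: k n => [|k IHk] n; first by rewrite mul1r subn0.
by rewrite exprS -mulrA coef_qM; case: n.
Qed.

Lemma coef_qX k n : (q ^+ k) n = (n == k)%N%:R.
Proof.
rewrite -[q ^+ k]mulr1 coef_qXM fps1 subn_eq0 eqn_leq.
by case: (k <= n)%N; rewrite ?andbT ?andbF.
Qed.

Lemma geom_unit a : (0 < a)%N -> (1 - q ^+ a) * geom a = 1.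
Proof.
move=> a_gt0; apply/funext => n; rewrite mulrBl mul1r fpsB coef_qXM fps1 /geom.
case: leqP => [le_an | lt_na].
  rewrite dvdn_subl // subrr; case: n le_an => // le_a0.
  by rewrite leqn0 in le_a0; rewrite (eqP le_a0) in a_gt0.
rewrite subr0; case: n lt_na => [|n] lt_na; first by rewrite dvdn0.
by rewrite gtnNdvd.
Qed.

(** Oriented for [qring]: it turns [q ^+ (2 * y)] into the square of the atom [q ^+ y], so that
    [ring] can compare exponents. *)
Lemma exprMl (R : pzSemiRingType) (x : R) m n : x ^+ (m * n) = x ^+ n ^+ m.
Proof. by rewrite mulnC exprM. Qed.

Ltac qring := try rewrite !(exprD, exprMl); ring.

Lemma geom_double a : (0 < a)%N -> geom a = (1 + q ^+ a) * geom (2 * a).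
Proof.
move=> a_gt0; have a2_gt0 : (0 < 2 * a)%N by rewrite muln_gt0.
transitivity (geom a * ((1 - q ^+ (2 * a)) * geom (2 * a))).
  by rewrite geom_unit // mulr1.
transitivity ((1 - q ^+ a) * geom a * ((1 + q ^+ a) * geom (2 * a))); first by qring.
by rewrite geom_unit // mul1r.
Qed.

Lemma geom_sub a d : (0 < a)%N ->
  geom a - geom (a + d) = q ^+ a * (1 - q ^+ d) * geom a * geom (a + d).
Proof.
move=> a_gt0; have ad_gt0 : (0 < a + d)%N by rewrite ltn_addr.
transitivity (geom a * ((1 - q ^+ (a + d)) * geom (a + d))
              - geom (a + d) * ((1 - q ^+ a) * geom a)); last by qring.
by rewrite !geom_unit // !mulr1.
Qed.

Lemma geom_sub2 a d e : (0 < a)%N ->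
  geom a * geom (a + d + e) - geom (a + d) * geom (a + e)
  = q ^+ a * (1 - q ^+ d) * (1 - q ^+ e)
    * (geom a * geom (a + d + e) * geom (a + d) * geom (a + e)).
Proof.
move=> a_gt0.
transitivity
  (geom a * geom (a + d + e) * ((1 - q ^+ (a + d)) * geom (a + d))
      * ((1 - q ^+ (a + e)) * geom (a + e))
   - geom (a + d) * geom (a + e) * ((1 - q ^+ a) * geom a)
      * ((1 - q ^+ (a + d + e)) * geom (a + d + e))); last by qring.
by rewrite !geom_unit ?mulr1 // -?addnA ltn_addr.
Qed.

(** * Closed forms for the first exchange *)

Definition evens (k : nat) : fps := \sum_(i < k) q ^+ (2 * i).

Lemma evens_geom k : (1 - q ^+ 2) * evens k = 1 - q ^+ (2 * k).
Proof.
elim: k => [|k IHk]; first by rewrite /evens big_ord0 muln0 expr0; ring.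
rewrite /evens big_ord_recr -/(evens k) mulrDr IHk mulnS; qring.
Qed.

(** With P_1 = (1 + q) P_2 and P_y = (1 + q^y) P_(2y), the factor P_2 P_(2y) is common, and the
    numerator left is (1 - q^(y-1)) (q + q^(y+2)). Since y is odd, y - 1 = 2(h + 1), so P_2 turns 1
    - q^(y-1) into a polynomial with nonnegative coefficients. *)
Lemma base_sub h (y := (2 * h + 3)%N) :
  geom 1 * geom (y + 2) * geom (2 * y) - geom 2 * geom y * geom (2 * y + 1)
  = evens (h + 1) * (q + q ^+ (y + 2))
    * (geom (y + 2) * geom (2 * y) * geom (2 * y + 1)).
Proof.
rewrite (@geom_double 1) // (@geom_double y) ?addn_gt0 ?orbT //.
have gu : (1 - q ^+ (y + 2)) * geom (y + 2) = 1 by rewrite geom_unit ?addn_gt0 ?orbT.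
have gs : (1 - q ^+ (2 * y + 1)) * geom (2 * y + 1) = 1.
  by rewrite geom_unit ?addn_gt0 ?orbT.
transitivity (geom 2 * geom (2 * y) *
   ((1 + q) * geom (y + 2) * ((1 - q ^+ (2 * y + 1)) * geom (2 * y + 1)) -
    (1 + q ^+ y) * geom (2 * y + 1) * ((1 - q ^+ (y + 2)) * geom (y + 2)))).
  by rewrite gu gs; qring.
transitivity (geom 2 * (1 - q ^+ (2 * (h + 1))) * (q + q ^+ (y + 2))
    * (geom (y + 2) * geom (2 * y) * geom (2 * y + 1))); first by rewrite /y; qring.
rewrite -evens_geom.
transitivity (((1 - q ^+ 2) * geom 2) * evens (h + 1) * (q + q ^+ (y + 2))
    * (geom (y + 2) * geom (2 * y) * geom (2 * y + 1))); first by qring.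
by rewrite geom_unit // mul1r.
Qed.

(** From 1 - q^(a+b) = (1 - q^b) + q^b (1 - q^a): two available factors absorb a gap equal to the
    sum of their parts. *)
Lemma geom_mul_sub a b : (0 < a)%N -> (0 < b)%N ->
  (1 - q ^+ (a + b)) * (geom a * geom b) = geom a + q ^+ b * geom b.
Proof.
move=> a_gt0 b_gt0.
transitivity (geom a * ((1 - q ^+ b) * geom b)
              + q ^+ b * geom b * ((1 - q ^+ a) * geom a)); first by qring.
by rewrite !geom_unit // !mulr1.
Qed.

(** The gain of [base_sub] has to pay for raising 3y + 2 to 3y + 4. That loss contains 1 - q^2, and
    (1 - q^2) P_1 = 1 + q, after which gain and loss share the factor P_(3y+2) P_(y+2) P_(2y). *)
Lemma base2_sub h (y := (2 * h + 3)%N) :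
  geom 1 * geom (y + 2) * geom (2 * y) * geom (3 * y + 4)
  - geom 2 * geom y * geom (2 * y + 1) * geom (3 * y + 2)
  = (q + q ^+ (y + 2)) * geom (2 * y + 1) * geom (3 * y + 4)
      * (geom (3 * y + 2) * geom (y + 2)
         + (evens (h + 1) - 1) * geom (y + 2) * geom (2 * y))
    + q ^+ (2 * y + 1) * geom (2 * y) * geom (3 * y + 4) * geom (3 * y + 2).
Proof.
have y_gt0 : (0 < y)%N by rewrite addn_gt0 orbT.
have gu : (1 - q ^+ (y + 2)) * geom (y + 2) = 1 by rewrite geom_unit ?addn_gt0 ?orbT.
have gv : (1 - q ^+ (2 * y)) * geom (2 * y) = 1 by rewrite geom_unit ?muln_gt0.
have gs : (1 - q ^+ (2 * y + 1)) * geom (2 * y + 1) = 1.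
  by rewrite geom_unit ?addn_gt0 ?orbT.
have gt : (1 - q ^+ (3 * y + 4)) * geom (3 * y + 4) = 1.
  by rewrite geom_unit ?addn_gt0 ?orbT.
have guv : (1 - q ^+ (3 * y + 2)) * geom (3 * y + 2) = 1.
  by rewrite geom_unit ?addn_gt0 ?orbT.
have sub_b : geom (3 * y + 2) - geom (3 * y + 4)
    = q ^+ (3 * y + 2) * (1 - q ^+ 2) * geom (3 * y + 2) * geom (3 * y + 4).
  by have := @geom_sub (3 * y + 2) 2; rewrite -addnA; apply; rewrite addn_gt0 orbT.
have g1 : (1 - q ^+ 2) * geom 1 = 1 + q.
  transitivity ((1 + q) * ((1 - q ^+ 1) * geom 1)); first ring.
  by rewrite geom_unit // mulr1.
transitivity
  ((geom 1 * geom (y + 2) * geom (2 * y) - geom 2 * geom y * geom (2 * y + 1))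
     * geom (3 * y + 2)
   - geom 1 * geom (y + 2) * geom (2 * y)
     * (geom (3 * y + 2) - geom (3 * y + 4))); first by qring.
rewrite base_sub -/y sub_b.
transitivity (geom (3 * y + 2) * geom (y + 2) * geom (2 * y) *
  (evens (h + 1) * (q + q ^+ (y + 2)) * geom (2 * y + 1)
   - q ^+ (3 * y + 2) * ((1 - q ^+ 2) * geom 1) * geom (3 * y + 4))); first by qring.
rewrite g1.
(* With u, v, s, t the powers of q at y + 2, 2y, 2y + 1, 3y + 4, this is
   P (1 - t) - v (1 - s) = (1 - v) + (P - 1) (1 - uv), P := evens (h + 1). *)
have key : evens (h + 1) * geom (2 * y + 1) - q ^+ (2 * y) * geom (3 * y + 4)
    = geom (2 * y + 1) * geom (3 * y + 4)
      * ((1 - q ^+ (2 * y)) + (evens (h + 1) - 1) * (1 - q ^+ (3 * y + 2))).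
  transitivity (geom (2 * y + 1) * evens (h + 1)
                  * ((1 - q ^+ (3 * y + 4)) * geom (3 * y + 4))
                - q ^+ (2 * y) * geom (3 * y + 4)
                  * ((1 - q ^+ (2 * y + 1)) * geom (2 * y + 1))).
    by rewrite gs gt; qring.
  (* The exponents match because 2y + (2y + 1) = (3y + 2) + 2(h + 1). *)
  have -> : q ^+ (2 * y) * geom (3 * y + 4)
              * ((1 - q ^+ (2 * y + 1)) * geom (2 * y + 1))
      = geom (2 * y + 1) * geom (3 * y + 4)
        * (q ^+ (2 * y) - q ^+ (3 * y + 2) * q ^+ (2 * (h + 1))).
    by rewrite /y; qring.
  have -> : q ^+ (2 * (h + 1)) = 1 - (1 - q ^+ 2) * evens (h + 1).
    by rewrite evens_geom; qring.
  qring.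
(* By q^(3y+2) (1 + q) = q^(2y) (q + q^(y+2)) - q^(2y+1) (1 - q^(y+2)), the loss is charged to the
   factor q + q^(y+2) of the gain, with a nonnegative surplus. *)
transitivity (geom (3 * y + 2) * geom (y + 2) * geom (2 * y) *
  ((q + q ^+ (y + 2)) * (evens (h + 1) * geom (2 * y + 1)
                         - q ^+ (2 * y) * geom (3 * y + 4))
   + q ^+ (2 * y + 1) * geom (3 * y + 4) * (1 - q ^+ (y + 2)))); first by qring.
rewrite key.
transitivity ((q + q ^+ (y + 2)) * geom (2 * y + 1) * geom (3 * y + 4)
  * (geom (3 * y + 2) * geom (y + 2) * ((1 - q ^+ (2 * y)) * geom (2 * y))
     + ((1 - q ^+ (3 * y + 2)) * geom (3 * y + 2)) * (evens (h + 1) - 1)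
       * geom (y + 2) * geom (2 * y))
  + q ^+ (2 * y + 1) * geom (3 * y + 4) * geom (3 * y + 2) * geom (2 * y)
    * ((1 - q ^+ (y + 2)) * geom (y + 2))); first by qring.
rewrite gu gv guv; qring.
Qed.

(** * The coefficientwise order *)

Definition fle (f g : fps) := forall n, f n <= g n.

Lemma fle_refl f : fle f f. Proof. by []. Qed.

Lemma fle_trans g f h : fle f g -> fle g h -> fle f h.
Proof. by move=> fg gh n; apply: le_trans (fg n) (gh n). Qed.

Lemma fle_subl f g : fle 0 (g - f) -> fle f g.
Proof. by move=> fg n; rewrite -subr_ge0; exact: (fg n). Qed.

Lemma fps_ge0D f g : fle 0 f -> fle 0 g -> fle 0 (f + g).
Proof. by move=> f0 g0 n; apply: addr_ge0; [exact: (f0 n) | exact: (g0 n)]. Qed.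

Lemma fps_ge0M f g : fle 0 f -> fle 0 g -> fle 0 (f * g).
Proof.
move=> f0 g0 n; rewrite fpsM sumr_ge0 // => i _.
by apply: mulr_ge0; [exact: (f0 i) | exact: (g0 (n - i)%N)].
Qed.

Lemma fle_mul2l h f g : fle 0 h -> fle f g -> fle (h * f) (h * g).
Proof.
move=> h0 fg n; rewrite !fpsM ler_sum // => i _.
by apply: ler_wpM2l; [exact: (h0 i) | exact: fg].
Qed.

Lemma geom_ge0 a : fle 0 (geom a).
Proof. by move=> n; rewrite /geom ler0n. Qed.

Lemma qX_ge0 k : fle 0 (q ^+ k).
Proof. by move=> n; rewrite coef_qX ler0n. Qed.

Lemma q_ge0 : fle 0 q.
Proof. by move=> n; rewrite /q ler0n. Qed.

Lemma fps1_ge0 : fle 0 1.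
Proof. by move=> n; rewrite fps1 ler0n. Qed.

Lemma prod_ge0 (s : seq nat) (F : nat -> fps) :
  (forall j, fle 0 (F j)) -> fle 0 (\prod_(j <- s) F j).
Proof.
by move=> F0; elim/big_ind: _; [exact: fps1_ge0 | exact: fps_ge0M | move=> j _].
Qed.

Lemma sum_ge0 k (F : 'I_k -> fps) :
  (forall j, fle 0 (F j)) -> fle 0 (\sum_j F j).
Proof.
by move=> F0; elim/big_ind: _; [exact: fle_refl | exact: fps_ge0D | move=> j _].
Qed.

Lemma evens_ge0 k : fle 0 (evens k).
Proof. by apply: sum_ge0 => j; exact: qX_ge0. Qed.

Lemma evensS_sub1_ge0 k : fle 0 (evens (k + 1) - 1).
Proof.
rewrite addn1 /evens big_ord_recl muln0 expr0 addrC addKr.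
by apply: sum_ge0 => j; exact: qX_ge0.
Qed.

Create HintDb fps_ge0.
#[export] Hint Resolve geom_ge0 qX_ge0 q_ge0 fps1_ge0 evens_ge0 evensS_sub1_ge0
  fps_ge0M fps_ge0D : fps_ge0.

Lemma geom_ge1 a : fle 1 (geom a).
Proof. by case=> [|n]; rewrite /geom fps1 ?dvdn0 ?ler0n. Qed.

Lemma fle1_ge0 f : fle 1 f -> fle 0 f.
Proof. exact: fle_trans fps1_ge0. Qed.

Lemma fle1M f g : fle 1 f -> fle 1 g -> fle 1 (f * g).
Proof.
move=> f1 g1; apply: (@fle_trans f) => //.
by rewrite -[X in fle X _]mulr1; apply: fle_mul2l => //; exact: fle1_ge0.
Qed.

Lemma fle_mulr1 f g : fle 0 f -> fle 1 g -> fle f (f * g).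
Proof. by move=> f0 g1; rewrite -[X in fle X _]mulr1; exact: fle_mul2l. Qed.

Lemma fps_sub_ge0 f g : fle f g -> fle 0 (g - f).
Proof. by move=> fg n; rewrite fpsB subr_ge0; exact: fg. Qed.

Lemma prod_ge1 (s : seq nat) (F : nat -> fps) :
  (forall j, fle 1 (F j)) -> fle 1 (\prod_(j <- s) F j).
Proof.
by move=> F1; elim/big_ind: _; [exact: fle_refl | exact: fle1M | move=> j _].
Qed.

#[export] Hint Resolve geom_ge1 fle1M prod_ge0 prod_ge1 fps_sub_ge0 : fps_ge0.
Ltac ge0 := by auto 20 with fps_ge0.

(** [G] acts as a catalyst: it is still there after each exchange of one factor, so a single copy
    serves the whole product. *)
Lemma fle_prod (G : fps) (s : seq nat) (f g : nat -> fps) :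
  (forall j, fle 0 (f j)) -> (forall j, fle 0 (g j)) ->
  (forall j, fle (G * f j) (G * g j)) ->
  fle (G * \prod_(j <- s) f j) (G * \prod_(j <- s) g j).
Proof.
move=> f0 g0 fg; elim: s => [|j s IHs]; first by rewrite !big_nil.
rewrite !big_cons; apply: (@fle_trans (g j * (G * \prod_(i <- s) f i))).
  rewrite mulrA [X in fle _ X]mulrA (mulrC (g j)).
  rewrite (mulrC _ (\prod_(i <- s) f i)) [X in fle _ X]mulrC.
  by apply: fle_mul2l; [exact: prod_ge0 | exact: fg].
by rewrite [X in fle _ X]mulrCA; apply: fle_mul2l.
Qed.

(** For d = 1 the difference contains (1 - q) P_1 = 1; larger d follow by unit steps. *)
Lemma fle_geom_step a d : (0 < a)%N -> (0 < d)%N ->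
  fle (geom 1 * geom (a + d)) (geom 1 * geom a).
Proof.
move=> a_gt0 d_gt0; elim: d d_gt0 => // d IHd _.
have stepd b : (0 < b)%N -> fle (geom 1 * geom (b + 1)) (geom 1 * geom b).
  move=> b_gt0; apply: fle_subl; rewrite -mulrBr geom_sub //.
  have -> : geom 1 * (q ^+ b * (1 - q ^+ 1) * geom b * geom (b + 1))
    = ((1 - q ^+ 1) * geom 1) * (q ^+ b * geom b * geom (b + 1)) by ring.
  by rewrite geom_unit // mul1r; ge0.
case: d IHd => [_|d IHd]; first exact: stepd.
apply: fle_trans (IHd isT); rewrite -[d.+2]addn1 addnA.
by apply: stepd; rewrite ltn_addr.
Qed.

(** * Splitting the products, and the exchange of shifted triples *)

Lemma inv_qpochE a m L :
  inv_qpoch a m L = \prod_(j <- iota 0 L) geom (a + m * j).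
Proof.
by rewrite /inv_qpoch; elim: (iota 0 L) => [|j s IHs];
  rewrite ?big_nil // big_cons -IHs.
Qed.

Lemma inv_qpochsE a b c m L :
  inv_qpochs [:: a; b; c] m L
  = inv_qpoch a m L * inv_qpoch b m L * inv_qpoch c m L.
Proof.
rewrite -mulrA -[X in _ = _ * (_ * X)]mulr1; reflexivity.
Qed.

Lemma inv_qpoch1 a m : inv_qpoch a m 1 = geom a.
Proof. by rewrite inv_qpochE big_seq1 muln0 addn0. Qed.

Lemma inv_qpochS a m l :
  inv_qpoch a m l.+1 = geom a * \prod_(j <- iota 1 l) geom (a + m * j).
Proof. by rewrite inv_qpochE big_cons muln0 addn0. Qed.

Lemma inv_qpoch_last a m l :
  inv_qpoch a m l.+2
  = geom a * \prod_(j <- iota 1 l) geom (a + m * j) * geom (a + m * l.+1).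
Proof.
by rewrite inv_qpochS -[X in iota 1 X]addn1 iotaD big_cat big_seq1 add1n mulrA.
Qed.

(** Serves the residues y and y + 2, whose first two factors enter the first exchange. The others
    are indexed one ahead, to meet the middle factors of [inv_qpoch_last]. *)
Lemma inv_qpoch_second a m l :
  inv_qpoch a m l.+2
  = geom a * geom (a + m) * \prod_(j <- iota 1 l) geom (a + m * j.+1).
Proof.
have iotaS : iota 1 l.+1 = 1%N :: [seq j.+1 | j <- iota 1 l].
  by rewrite -(iotaDl 1 1).
by rewrite inv_qpochS iotaS big_cons muln1 mulrA big_map.
Qed.

Lemma inv_qpoch_ge1 a m L : fle 1 (inv_qpoch a m L).
Proof. by rewrite inv_qpochE; apply: prod_ge1 => j; exact: geom_ge1. Qed.

#[export] Hint Resolve inv_qpoch_ge1 fle1_ge0 : fps_ge0.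

(** Two exchanges of pairs with equal sums, through the part 3y + 3 + mj ([mid]): first 2y + 1 + mj
    and y + m(j+1) become 2y + mj and [mid], then 2 + mj and [mid] become 1 + mj and y + 2 + m(j+1).
    The gaps are 1 and y + 2, then 1 and 3y + 2 = (y + 2) + 2y, all absorbed by P_1 P_(y+2)
    P_(2y). *)
Lemma triple_step y m j (y_gt0 : (0 < y)%N) (m_def : m = (2 * y + 2)%N) :
  fle (geom 1 * geom (y + 2) * geom (2 * y)
         * (geom (2 + m * j) * geom (2 * y + 1 + m * j) * geom (y + m * j.+1)))
      (geom 1 * geom (y + 2) * geom (2 * y)
         * (geom (1 + m * j) * geom (2 * y + m * j) * geom (y + 2 + m * j.+1))).
Proof.
set G := geom 1 * _ * _.
have := @geom_sub2 (2 * y + m * j) 1 (y + 2) (ltac:(lia)).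
have := @geom_sub2 (1 + m * j) 1 (3 * y + 2) (ltac:(lia)).
have -> : (1 + m * j + 1 = 2 + m * j)%N by lia.
have -> : (2 * y + m * j + 1 = 2 * y + 1 + m * j)%N by lia.
have -> : (2 + m * j + (3 * y + 2) = y + 2 + m * j.+1)%N by lia.
have -> : (2 * y + m * j + (y + 2) = y + m * j.+1)%N by lia.
have -> : (2 * y + 1 + m * j + (y + 2) = 1 + m * j + (3 * y + 2))%N by lia.
set mid := geom (1 + m * j + (3 * y + 2)).
set al := geom (1 + m * j); set be := geom (y + 2 + _).
set ga := geom (2 * y + m * j).
set a := geom (2 + _); set b := geom (y + _); set c := geom (2 * y + 1 + _).
move=> e1 e2.
apply: fle_subl.
have g1 : (1 - q ^+ 1) * geom 1 = 1 by rewrite geom_unit.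
have gu : (1 - q ^+ (y + 2)) * geom (y + 2) = 1.
  by rewrite geom_unit ?addn_gt0 ?orbT.
have guv := @geom_mul_sub (y + 2) (2 * y) (ltac:(lia)) (ltac:(lia)).
have -> : G * (al * ga * be) - G * (a * c * b)
    = q ^+ (1 + m * j) * (((1 - q ^+ 1) * geom 1)
        * ((1 - q ^+ (y + 2 + 2 * y)) * (geom (y + 2) * geom (2 * y))))
        * (ga * (al * be * a * mid))
    + q ^+ (2 * y + m * j) * ((1 - q ^+ 1) * geom 1)
        * ((1 - q ^+ (y + 2)) * geom (y + 2)) * (geom (2 * y) * a * (ga * mid * c * b)).
  transitivity (G * (ga * (al * be - a * mid) + a * (ga * mid - c * b))).
    ring.
  rewrite e1 e2 /G.
  have -> : (3 * y + 2 = y + 2 + 2 * y)%N by lia.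
  ring.
rewrite g1 gu guv /al /be /ga /a /b /c /mid; ge0.
Qed.

(** * Factors congruent to 1 up to degree n, and coefficient recursion *)

Definition fps_low n (f : fps) := forall k, (k <= n)%N -> f k = (1 : fps) k.

Lemma coefM_low n f g : fps_low n g -> (f * g) n = f n.
Proof.
move=> g1; rewrite -[in RHS](mulr1 f) !fpsM; apply: eq_bigr => i _.
by rewrite g1 // leq_subr.
Qed.

Lemma fps_lowM n f g : fps_low n f -> fps_low n g -> fps_low n (f * g).
Proof.
move=> f1 g1 k le_kn; rewrite (@coefM_low k) ?f1 // => i le_ik.
by rewrite g1 // (leq_trans le_ik).
Qed.

Lemma fps_low_geom n a : (n < a)%N -> fps_low n (geom a).
Proof.
move=> lt_na [|k] le_kn; first by rewrite /geom fps1 dvdn0.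
by rewrite /geom fps1 gtnNdvd // (leq_ltn_trans le_kn).
Qed.

Lemma fps_low_prod n (s : seq nat) (F : nat -> fps) :
  {in s, forall j, fps_low n (F j)} -> fps_low n (\prod_(j <- s) F j).
Proof.
by move=> F1; rewrite big_seq; elim/big_ind: _ => //; exact: fps_lowM.
Qed.

Lemma inv_qpoch_low n a m l : (n < m + a)%N ->
  exists2 F, fps_low n F & inv_qpoch a m l.+1 = geom a * F.
Proof.
move=> lt_n; rewrite inv_qpochS; eexists; last reflexivity.
apply: fps_low_prod => j; rewrite mem_iota => /andP[j_gt0 _].
apply: fps_low_geom; nia.
Qed.

Lemma inv_qpochs_low n a b c m l :
  (n < m + a)%N -> (n < m + b)%N -> (n < m + c)%N ->
  inv_qpochs [:: a; b; c] m l.+1 n = (geom a * geom b * geom c) n.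
Proof.
move=> /inv_qpoch_low-/(_ l)[Fa la ea] /inv_qpoch_low-/(_ l)[Fb lb eb].
move=> /inv_qpoch_low-/(_ l)[Fc lc ec].
rewrite inv_qpochsE ea eb ec.
have -> : geom a * Fa * (geom b * Fb) * (geom c * Fc)
        = geom a * geom b * geom c * (Fa * Fb * Fc) by ring.
by apply: coefM_low; do 2?apply: fps_lowM.
Qed.

Lemma geom_rec a : (0 < a)%N -> geom a = 1 + q ^+ a * geom a.
Proof. by move=> a_gt0; rewrite -[X in X + _](geom_unit a a_gt0); ring. Qed.

(** Either the part a does not occur, or one copy is removed; iterated, this evaluates concrete
    coefficients. *)
Lemma coef_geomM a f n : (0 < a)%N ->
  (geom a * f) n = f n + (if (a <= n)%N then (geom a * f) (n - a)%N else 0).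
Proof.
by move=> a_gt0; rewrite {1}geom_rec // mulrDl mul1r -mulrA fpsD coef_qXM.
Qed.

(** * Exponents reached by the first exchange *)

Lemma coef_gt0M f g a b : fle 0 f -> fle 0 g -> 0 < f a -> 0 < g b ->
  0 < (f * g) (a + b)%N.
Proof.
move=> f0 g0 fa gb; have lt_a : (a < (a + b).+1)%N by rewrite ltnS leq_addr.
rewrite fpsM (bigD1 (Ordinal lt_a)) //= addKn.
apply: ltr_wpDr; last exact: mulr_gt0.
by apply: sumr_ge0 => i _; apply: mulr_ge0; [exact: (f0 i) | exact: g0].
Qed.

Lemma coef_gt0D f g n : fle 0 f -> fle 0 g -> 0 < f n \/ 0 < g n ->
  0 < (f + g) n.
Proof.
move=> f0 g0 [fn | gn]; rewrite fpsD.
  by apply: ltr_wpDr => //; exact: (g0 n).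
by apply: ltr_wpDl => //; exact: (f0 n).
Qed.

Lemma geom_gt0 a k : 0 < geom a (a * k)%N.
Proof. by rewrite /geom dvdn_mulr. Qed.

Lemma geom_gt0_0 a : 0 < geom a 0%N.
Proof. by rewrite /geom dvdn0. Qed.

Lemma evens_sub1_gt0 h i : (0 < i <= h)%N -> 0 < (evens (h + 1) - 1) (2 * i)%N.
Proof.
case: i => // i /= lt_ih.
rewrite addn1 /evens big_ord_recl muln0 expr0 addrC addKr.
rewrite (bigD1 (Ordinal lt_ih)) //=; apply: coef_gt0D.
- exact: qX_ge0.
- by rewrite big_mkcond; apply: sum_ge0 => j; case: ifP => _; ge0.
- by left; rewrite coef_qX eqxx.
Qed.

(* A common minorant of [base] and [base2] below; its support is all that is
   needed, except for the exponent 14 (and the special 9) when [y = 3]. *)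
Definition witness h : fps := let y := (2 * h + 3)%N in
  (q + q ^+ (y + 2)) * (1 + (evens (h + 1) - 1) * geom (2 * y))
    * geom (2 * y + 1) * geom (y + 2) + q ^+ (2 * y + 1).

Lemma witness_ge0 h : fle 0 (witness h).
Proof. by rewrite /witness; ge0. Qed.

(** The value of [base_sub], hence the whole difference for L = 1 and x = y + 2; [base2] is its
    analogue for the first move when L >= 2. *)
Definition base h : fps := let y := (2 * h + 3)%N in
  evens (h + 1) * (q + q ^+ (y + 2))
    * (geom (y + 2) * geom (2 * y) * geom (2 * y + 1)).

Definition base2 h : fps := let y := (2 * h + 3)%N in
  (q + q ^+ (y + 2)) * geom (2 * y + 1) * geom (3 * y + 4)
      * (geom (3 * y + 2) * geom (y + 2)
         + (evens (h + 1) - 1) * geom (y + 2) * geom (2 * y))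
    + q ^+ (2 * y + 1) * geom (2 * y) * geom (3 * y + 4) * geom (3 * y + 2).

(** The difference reduces to a multiple of P_(2y) - 1 = q^(2y) P_(2y) minus q^(2y+1); the latter is
    paid by the constant term of the product multiplying q q^(2y). *)
Lemma witness_le_base h : fle (witness h) (base h).
Proof.
apply: fle_subl; rewrite /witness /base.
set y := (2 * h + 3)%N; set P := evens (h + 1).
have gv : geom (2 * y) = 1 + q ^+ (2 * y) * geom (2 * y).
  by apply: geom_rec; lia.
have -> : P * (q + q ^+ (y + 2))
      * (geom (y + 2) * geom (2 * y) * geom (2 * y + 1))
    - ((q + q ^+ (y + 2)) * (1 + (P - 1) * geom (2 * y))
        * geom (2 * y + 1) * geom (y + 2) + q ^+ (2 * y + 1))
  = q ^+ (2 * y) * q * (geom (y + 2) * geom (2 * y + 1) * geom (2 * y) - 1)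
    + q ^+ (y + 2) * q ^+ (2 * y)
      * (geom (y + 2) * geom (2 * y + 1) * geom (2 * y)).
  transitivity ((q + q ^+ (y + 2)) * geom (2 * y + 1) * geom (y + 2)
                  * (geom (2 * y) - 1) - q ^+ (2 * y + 1)); first by qring.
  by rewrite {1}gv; qring.
ge0.
Qed.

(** [witness] arises from [base2] by replacing factors P_a >= 1 by 1. *)
Lemma witness_le_base2 h : fle (witness h) (base2 h).
Proof.
apply: fle_subl; rewrite /witness /base2.
set y := (2 * h + 3)%N; set P := evens (h + 1).
set lhs := (X in fle 0 X).
have -> : lhs = (q + q ^+ (y + 2)) * geom (2 * y + 1) * geom (y + 2)
      * ((geom (3 * y + 4) * geom (3 * y + 2) - 1)
         + (P - 1) * geom (2 * y) * (geom (3 * y + 4) - 1))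
    + q ^+ (2 * y + 1)
      * (geom (2 * y) * geom (3 * y + 4) * geom (3 * y + 2) - 1).
  by rewrite /lhs; ring.
rewrite /P; ge0.
Qed.

Lemma base_ge0 h : fle 0 (base h).
Proof. exact: fle_trans (witness_ge0 h) (witness_le_base h). Qed.

Lemma base2_ge0 h : fle 0 (base2 h).
Proof. exact: fle_trans (witness_ge0 h) (witness_le_base2 h). Qed.

(** One exponent is chosen from each factor. A multiple of 2y is allowed only together with i > 0,
    since P_(2y) multiplies [evens (h + 1) - 1], which has no constant term. *)
Lemma witness_gt0 h n e i c j k (y := (2 * h + 3)%N) :
  e = 1%N \/ e = (y + 2)%N -> (i <= h)%N -> (i = 0 -> c = 0)%N ->
  n = (e + (2 * i + 2 * y * c) + (2 * y + 1) * j + (y + 2) * k)%N ->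
  0 < witness h n.
Proof.
move=> e_eq le_ih ic ->; rewrite /witness -/y.
have eg0 : fle 0 (q + q ^+ (y + 2)) by ge0.
have Pg0 : fle 0 (1 + (evens (h + 1) - 1) * geom (2 * y)) by ge0.
apply: coef_gt0D; [ge0 | ge0 | left].
apply: coef_gt0M; [ge0 | ge0 | | exact: geom_gt0].
apply: coef_gt0M; [ge0 | ge0 | | exact: geom_gt0].
apply: coef_gt0M; [ge0 | ge0 | | ].
  apply: coef_gt0D; [ge0 | ge0 |].
  by case: e_eq => ->; [left | right; rewrite coef_qX eqxx].
apply: coef_gt0D; [ge0 | ge0 |].
case: (posnP i) => [i0 | i_gt0]; first by left; rewrite i0 ic // !muln0 fps1.
right; apply: coef_gt0M; [ge0 | ge0 | | exact: geom_gt0].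
by apply: evens_sub1_gt0; rewrite i_gt0.
Qed.

Lemma witness_gt0_v h : 0 < witness h (2 * (2 * h + 3) + 1)%N.
Proof.
by apply: coef_gt0D; [ge0 | ge0 | right; rewrite coef_qX eqxx].
Qed.

(** Below 2y + 3 parity decides. From there on, n - (2y + 3) is divided by y + 2: copies of the part
    y + 2 supply the quotient, and each remainder r gets its own choice of the other exponents. *)
Lemma witness_gt0P h n (y := (2 * h + 3)%N) : (0 < n)%N ->
  ~ ((n < y + 2)%N /\ ~~ odd n) -> n <> y ->
  (h = 0%N -> n <> 9%N /\ n <> 14%N) -> 0 < witness h n.
Proof.
move=> n_gt0 n_even n_y n_h0.
have w e i c j k := @witness_gt0 h n e i c j k.
case: (ltnP n (2 * y + 3)) => n_big.
  case: (boolP (odd n)) => n_odd.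
    case: (ltnP n y) => lt_ny.
      by apply: (w 1%N n./2 0%N 0%N 0%N); rewrite -?/y /y in lt_ny *; lia.
    (* Starting from e = y + 2, this n would need i = h + 1, which is out of range; hence the extra
       term in [witness]. *)
    case: (eqVneq n (2 * y + 1)%N) => [-> | n_v]; first exact: witness_gt0_v.
    by apply: (w (y + 2)%N ((n - (y + 2)) %/ 2)%N 0%N 0%N 0%N);
      rewrite /y in lt_ny n_big n_v n_y *; lia.
  have {n_even} n_ge : (y + 2 <= n)%N by rewrite leqNgt; apply/negP => ?; apply: n_even.
  case: (ltnP n (2 * y + 2)) => n_s.
    by apply: (w 1%N ((n - (y + 3)) %/ 2)%N 0%N 0%N 1%N);
      rewrite /y in n_ge n_s *; lia.
  by apply: (w 1%N 0%N 0%N 1%N 0%N); rewrite /y in n_s n_big *; lia.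
have quot b : (b <= n)%N -> exists k r, (r < y + 2)%N /\ n = (b + r + (y + 2) * k)%N.
  move=> le_bn; exists ((n - b) %/ (y + 2))%N, ((n - b) %% (y + 2))%N.
  have y2_gt0 : (0 < y + 2)%N by rewrite addn_gt0 orbT.
  split; first by rewrite ltn_mod.
  by rewrite -addnA [X in (b + X)%N]addnC mulnC -divn_eq subnKC.
rewrite /y in n_big quot.
case: (posnP h) => [h0 | h_gt0]; last first.
  have [k [r [r_lt n_eq]]] := quot _ n_big.
  case: (boolP (odd r)) => r_odd.
    case: (ltnP r (2 * h)) => r1.
      by apply: (w 1%N ((r + 1) %/ 2)%N 0%N 1%N k); lia.
    case: (ltnP r (2 * h + 2)) => r2.
      by apply: (w (y + 2)%N h 0%N 0%N k.+1); rewrite /y; lia.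
    by apply: (w (y + 2)%N 0%N 0%N 1%N k); rewrite /y; lia.
  case: (ltnP r (2 * h)) => r1.
    by apply: (w 1%N ((r + 2) %/ 2)%N 1%N 0%N k); lia.
  case: (ltnP r (2 * h + 1)) => r2.
    by apply: (w 1%N h.-1 0%N 0%N k.+2); lia.
  case: (ltnP r (2 * h + 3)) => r3.
    by apply: (w 1%N h 0%N 0%N k.+2); lia.
  by apply: (w (y + 2)%N 1%N 1%N 0%N k); rewrite /y; lia.
(* For y = 3 the factor with [evens] is 1, so apart from 7 only 1 or 5 plus multiples of 5 and 7
   remain; these miss 9 and 14, and division by 5 starts at 15. *)
have [n9 n14] := n_h0 h0.
case: (ltnP n 15) => n15.
  have : (n = 10 \/ n = 11 \/ n = 12 \/ n = 13)%N by lia.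
  case=> [|[|[|]]] n_eq.
  - by apply: (w (y + 2)%N 0%N 0%N 0%N 1%N); rewrite /y; lia.
  - by apply: (w 1%N 0%N 0%N 0%N 2%N); lia.
  - by apply: (w (y + 2)%N 0%N 0%N 1%N 0%N); rewrite /y; lia.
  - by apply: (w 1%N 0%N 0%N 1%N 1%N); lia.
have [k [r [r_lt n_eq]]] := quot _ n15.
have : (r = 0 \/ r = 1 \/ r = 2 \/ r = 3 \/ r = 4)%N by lia.
case=> [|[|[|[|]]]] r_eq.
- by apply: (w (y + 2)%N 0%N 0%N 0%N k.+2); rewrite /y; lia.
- by apply: (w 1%N 0%N 0%N 0%N k.+3); lia.
- by apply: (w (y + 2)%N 0%N 0%N 1%N k.+1); rewrite /y; lia.
- by apply: (w 1%N 0%N 0%N 1%N k.+2); lia.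
- by apply: (w (y + 2)%N 0%N 0%N 2%N k); rewrite /y; lia.
Qed.

(** * The full difference and its dependence on x *)

Definition diff L y x : fps :=
  inv_qpochs [:: 1%N; x; (2 * y)%N] (2 * y + 2) L
  - inv_qpochs [:: 2%N; y; (2 * y + 1)%N] (2 * y + 2) L.

Lemma diff_base h (y := (2 * h + 3)%N) : diff 1 y (y + 2) = base h.
Proof.
by rewrite /diff !inv_qpochsE !inv_qpoch1 base_sub.
Qed.

Lemma diff_base2 h l (y := (2 * h + 3)%N) : fle (base2 h) (diff l.+2 y (y + 2)).
Proof.
apply: fle_subl; rewrite /diff; set m := (2 * y + 2)%N.
have y_gt0 : (0 < y)%N by rewrite addn_gt0 orbT.
pose G := geom 1 * geom (y + 2) * geom (2 * y).
pose f j := geom (2 + m * j) * geom (2 * y + 1 + m * j) * geom (y + m * j.+1).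
pose g j := geom (1 + m * j) * geom (2 * y + m * j) * geom (y + 2 + m * j.+1).
pose F := \prod_(j <- iota 1 l) f j.
pose K := \prod_(j <- iota 1 l) g j.
pose a := geom (2 + m * l.+1); pose c := geom (2 * y + 1 + m * l.+1).
pose al := geom (1 + m * l.+1); pose ga := geom (2 * y + m * l.+1).
have A_eq : inv_qpochs [:: 1%N; (y + 2)%N; (2 * y)%N] m l.+2
    = G * geom (3 * y + 4) * K * al * ga.
  rewrite inv_qpochsE (inv_qpoch_second (y + 2)) !inv_qpoch_last /K /g !big_split /=.
  have -> : (y + 2 + m = 3 * y + 4)%N by rewrite /m; lia.
  rewrite /G /al /ga; ring.
have B_eq : inv_qpochs [:: 2%N; y; (2 * y + 1)%N] m l.+2
    = geom 2 * geom y * geom (2 * y + 1) * geom (3 * y + 2) * F * a * c.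
  rewrite inv_qpochsE (inv_qpoch_second y) !inv_qpoch_last /F /f !big_split /=.
  have -> : (y + m = 3 * y + 2)%N by rewrite /m; lia.
  rewrite /a /c; ring.
have fK : fle (G * F) (G * K).
  by apply: fle_prod => j; [rewrite /f; ge0 | rewrite /g; ge0 | exact: triple_step].
have F1 : fle 1 F by apply: prod_ge1 => j; rewrite /f; ge0.
have K1 : fle 1 K by apply: prod_ge1 => j; rewrite /g; ge0.
have al_step : fle (geom 1 * a) (geom 1 * al).
  have := fle_geom_step (1 + m * l.+1) 1 (ltac:(lia)) isT.
  by rewrite addnAC.
have ga_step : fle (geom 1 * c) (geom 1 * ga).
  have := fle_geom_step (2 * y + m * l.+1) 1 (ltac:(lia)) isT.
  by rewrite /c addnAC.
rewrite A_eq B_eq.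
set X := base2 h.
have X_eq : G * geom (3 * y + 4)
    - geom 2 * geom y * geom (2 * y + 1) * geom (3 * y + 2) = X.
  exact: base2_sub.
(* Telescoping along the moves: the first exchange times the untouched factors [F * a * c], then [F]
   to [K] under [G], then [a] to [al] and [c] to [ga] under P_1. *)
have -> : G * geom (3 * y + 4) * K * al * ga
    - geom 2 * geom y * geom (2 * y + 1) * geom (3 * y + 2) * F * a * c - X
  = X * (F * a * c - 1)
    + geom (3 * y + 4) * (G * K - G * F) * a * c
    + geom (y + 2) * geom (2 * y) * geom (3 * y + 4) * K
      * ((geom 1 * al - geom 1 * a) * ga + a * (geom 1 * ga - geom 1 * c)).
  by rewrite -X_eq /G; ring.
have X0 : fle 0 X by exact: base2_ge0.
have G0 : fle 0 G by rewrite /G; ge0.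
rewrite /a /c /al /ga in al_step ga_step *; ge0.
Qed.

(** The factor j = 0 alone yields q^i P_i P_(i+1), because (1 - q) P_1 = 1; raising the other parts
    contributes a nonnegative amount. *)
Lemma geom_step_strict i l G m : (0 < i)%N -> fle 1 G ->
  fle (q ^+ i * geom i * geom (i + 1))
      (geom 1 * G * (inv_qpoch i m l.+1 - inv_qpoch (i + 1) m l.+1)).
Proof.
move=> i_gt0 G1; apply: fle_subl; rewrite !inv_qpochS.
pose f j := geom (i + m * j); pose g j := geom (i + 1 + m * j).
pose F := \prod_(j <- iota 1 l) f j; pose K := \prod_(j <- iota 1 l) g j.
have F1 : fle 1 F by apply: prod_ge1 => j; rewrite /f; ge0.
have KF : fle (geom 1 * K) (geom 1 * F).
  apply: fle_prod => j; rewrite /f /g; [ge0 | ge0 |].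
  by rewrite addnAC; apply: fle_geom_step; rewrite ?addn_gt0 ?i_gt0.
have step : geom 1 * geom i - geom 1 * geom (i + 1)
    = q ^+ i * geom i * geom (i + 1).
  rewrite -mulrBr geom_sub //.
  transitivity (((1 - q ^+ 1) * geom 1) * (q ^+ i * geom i * geom (i + 1))).
    by ring.
  by rewrite geom_unit // mul1r.
rewrite -/F -/K.
have -> : geom 1 * G * (geom i * F - geom (i + 1) * K)
      - q ^+ i * geom i * geom (i + 1)
    = q ^+ i * geom i * geom (i + 1) * (G * F - 1)
      + geom (i + 1) * G * (geom 1 * F - geom 1 * K).
  by rewrite -step; ring.
ge0.
Qed.

Lemma diff_step L y i : (0 < i)%N ->
  fle (q ^+ i * geom i * geom (i + 1)) (diff L.+1 y i - diff L.+1 y (i + 1)).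
Proof.
move=> i_gt0; rewrite /diff !inv_qpochsE; set m := (2 * y + 2)%N.
(* All factors of the first product except P_1 and those of residue i; the second product is the
   same for i and i + 1 and cancels. *)
have G1 : fle 1 (\prod_(j <- iota 1 L) geom (1 + m * j)
                 * inv_qpoch (2 * y) m L.+1).
  by apply: fle1M; ge0.
apply: (fle_trans _ _ _ (geom_step_strict i L _ m i_gt0 G1)).
rewrite (inv_qpochS 1).
apply: fle_subl; set lhs := (X in fle 0 X).
have -> : lhs = 0 by rewrite /lhs; ring.
exact: fle_refl.
Qed.

Lemma diff_anti L y i k : (0 < i <= k)%N -> fle (diff L.+1 y k) (diff L.+1 y i).
Proof.
move=> /andP[i_gt0]; elim: k => [|k IHk]; first by case: i i_gt0.
rewrite leq_eqVlt => /predU1P[-> //|]; rewrite ltnS => le_ik.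
apply: fle_trans (IHk le_ik); apply: fle_subl; rewrite -[k.+1]addn1.
have k_gt0 : (0 < k)%N by exact: leq_trans le_ik.
apply: fle_trans (diff_step L y k k_gt0); ge0.
Qed.

(** With D_x for the difference: D_x >= D_i >= D_(i+1) + q^i P_i P_(i+1) and D_(i+1) >= D_(y+2) >=
    0, so one productive increment suffices. *)
Lemma diff_gt0_step L y x i n : (0 < x <= i)%N -> (i <= y + 1)%N ->
  fle 0 (diff L.+1 y (y + 2)) ->
  0 < (q ^+ i * geom i * geom (i + 1)) n -> 0 < diff L.+1 y x n.
Proof.
move=> /andP[x_gt0 le_xi] le_iy D0 step_gt0.
have i_gt0 : (0 < i)%N by exact: leq_trans le_xi.
have le1 := diff_anti L y x i; rewrite x_gt0 in le1.
have le2 := diff_anti L y (i + 1) (y + 2).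
have := diff_step L y i i_gt0 n; rewrite fpsB => le3.
apply: lt_le_trans step_gt0 _; apply: le_trans le3 _.
rewrite lerBlDr -[X in X <= _]addr0 lerD //; first exact: le1.
by apply: le_trans (D0 n) _; apply: le2; lia.
Qed.

(** * Vanishing coefficients and the exponents 9 and 14 for y = 3 *)

Lemma diff_zero L y x n : (1 < y)%N -> odd y -> (n < x)%N -> (n <= y + 1)%N ->
  ~~ odd n \/ n = y -> diff L.+1 y x n = 0.
Proof.
move=> y_gt1 y_odd lt_nx le_ny n_eq; have y_gt0 : (0 < y)%N by exact: odd_gt0.
(* In degree n < x, n <= y + 1, the first product sees only the part 1 and gives 1. The second sees
   only 2 and the odd y, with a single partition: twos if n is even, y alone if n = y. *)
rewrite /diff fpsB !inv_qpochs_low; try lia.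
rewrite -mulrA coefM_low; last first.
  by apply: fps_lowM; apply: fps_low_geom; lia.
rewrite coefM_low; last by apply: fps_low_geom; lia.
rewrite {1}/geom dvd1n; apply/eqP; rewrite subr_eq0 eq_sym; apply/eqP.
rewrite mulrC coef_geomM //.
have geom2 k : geom 2 k = (~~ odd k)%:R by rewrite /geom dvdn2.
rewrite geom2; case: ltnP => [lt_ny | le_yn].
  by rewrite addr0; case: n_eq => [->|n_y] //; lia.
case: n_eq => [n_even | ->].
  have -> : (n - y = 1)%N by lia.
  by rewrite n_even coef_geomM // geom2; case: leqP => //; lia.
by rewrite y_odd subnn coef_geomM // geom2; case: leqP => //; lia.
Qed.

(** 14 = 1 + 6 + 7, using the part 2y = 6 that [witness] loses at h = 0. *)
Lemma base_14 : 0 < base 0 14%N.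
Proof.
apply: (coef_gt0M _ _ 1 13); [ge0 | ge0 | | ].
  apply: (coef_gt0M _ _ 0 1); [ge0 | ge0 | by rewrite /evens big_ord1 | ].
  by apply: coef_gt0D; [ge0 | ge0 | left].
apply: (coef_gt0M _ _ 6 7); [ge0 | ge0 | | exact: (geom_gt0 7 1)].
by apply: (coef_gt0M _ _ 0 6); [ge0 | ge0 | |].
Qed.

(** 14 = 1 + 13, with 13 = 3y + 4. *)
Lemma base2_14 : 0 < base2 0 14%N.
Proof.
apply: coef_gt0D; [ge0 | ge0 | left].
apply: (coef_gt0M _ _ 14 0); [ge0 | ge0 | | ].
  apply: (coef_gt0M _ _ 1 13); [ge0 | ge0 | | exact: (geom_gt0 13 1)].
  apply: (coef_gt0M _ _ 1 0); [ge0 | ge0 | | exact: geom_gt0_0].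
  by apply: coef_gt0D; [ge0 | ge0 | left].
apply: coef_gt0D; [ge0 | ge0 | left].
by apply: (coef_gt0M _ _ 0 0); [ge0 | ge0 | |].
Qed.

(** Neither 9 - 1 nor 9 - 5 is a sum of parts 5, 6, 7. *)
Lemma base_9 : base 0 9%N = 0.
Proof.
rewrite /base /evens big_ord1 muln0 expr0 mul1r mulrDl fpsD coef_qM coef_qXM /=.
by do !rewrite -?mulrA coef_geomM //=; rewrite /geom.
Qed.

(** The tie at L = 1 is broken by the new part 9 = 1 + 8 of the first product; the new parts of the
    second are at least 10. *)
Lemma diff_9 l : 0 < diff l.+2 3 5 9%N.
Proof.
have B9 : inv_qpochs [:: 2; 3; 7]%N 8 l.+2 9%N = (geom 2 * geom 3 * geom 7) 9%N.
  by rewrite inv_qpochs_low.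
have A9 : fle (geom 9 * (geom 1 * geom 5 * geom 6))
              (inv_qpochs [:: 1; 5; 6]%N 8 l.+2).
  rewrite inv_qpochsE inv_qpoch_second !inv_qpochS.
  set F1 := \prod_(j <- _) _; set F5 := \prod_(j <- _) _.
  set F6 := \prod_(j <- _) _.
  have F1_ge1 : fle 1 F1 by apply: prod_ge1 => j; exact: geom_ge1.
  have F5_ge1 : fle 1 F5 by apply: prod_ge1 => j; exact: geom_ge1.
  have F6_ge1 : fle 1 F6 by apply: prod_ge1 => j; exact: geom_ge1.
  apply: fle_trans (fle_mulr1 _ (F1 * F5 * F6) _ _) _; [ge0 | ge0 |].
  apply: fle_subl; set lhs := (X in fle 0 X).
  have -> : lhs = 0 by rewrite /lhs; ring.
  exact: fle_refl.
have G9 : (geom 1 * geom 5 * geom 6) 9%N = (geom 2 * geom 3 * geom 7) 9%N.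
  have := base_9; rewrite -diff_base /diff !inv_qpochsE !inv_qpoch1 fpsB.
  by move=> /eqP; rewrite subr_eq0 => /eqP.
change (0 < inv_qpochs [:: 1; 5; 6]%N 8 l.+2 9%N
            - inv_qpochs [:: 2; 3; 7]%N 8 l.+2 9%N).
rewrite B9 subr_gt0; apply: lt_le_trans (A9 9%N).
rewrite coef_geomM // G9 ltrDl.
apply: (coef_gt0M _ _ 0 0); [ge0 | ge0 | exact: geom_gt0_0 |].
apply: (coef_gt0M _ _ 0 0); [ge0 | ge0 | | exact: geom_gt0_0].
apply: (coef_gt0M _ _ 0 0); [ge0 | ge0 | |]; exact: geom_gt0_0.
Qed.

Lemma diff_ge0 L h (y := (2 * h + 3)%N) : fle 0 (diff L.+1 y (y + 2)).
Proof.
case: L => [|l]; first by rewrite diff_base; exact: base_ge0.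
exact: fle_trans (base2_ge0 h) (diff_base2 h l).
Qed.

Lemma diff_gt0 L h n (y := (2 * h + 3)%N) : (0 < n)%N ->
  ~ ((n < y + 2)%N /\ ~~ odd n) -> n <> y -> ~ [/\ L = 0, h = 0 & n = 9]%N ->
  0 < diff L.+1 y (y + 2) n.
Proof.
move=> n_gt0 n_even n_y n_9.
have base_lt : (h = 0 -> n <> 9)%N -> 0 < base h n.
  move=> n9; case: (EM (h = 0 /\ n = 14)%N) => [[-> ->] | n14].
    exact: base_14.
  apply: lt_le_trans (witness_le_base h n).
  by apply: witness_gt0P => // h0; split; [exact: n9 | move=> n_eq; exact: n14].
have base2_lt : (h = 0 -> n <> 9)%N -> 0 < base2 h n.
  move=> n9; case: (EM (h = 0 /\ n = 14)%N) => [[-> ->] | n14].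
    exact: base2_14.
  apply: lt_le_trans (witness_le_base2 h n).
  by apply: witness_gt0P => // h0; split; [exact: n9 | move=> n_eq; exact: n14].
case: L n_9 => [|l] n_9.
  by rewrite diff_base; apply: base_lt => h0 n9; exact: n_9.
case: (EM (h = 0 /\ n = 9)%N) => [[h0 ->] | n9].
  by rewrite /y h0; exact: diff_9.
apply: lt_le_trans (diff_base2 h l n).
by apply: base2_lt => h0 n_eq; exact: n9.
Qed.

Lemma diff_step_gt0 i : 0 < (q ^+ i * geom i * geom (i + 1)) i.
Proof.
have gt0M f g : fle 0 f -> fle 0 g -> 0 < f i -> 0 < g 0%N -> 0 < (f * g) i.
  by move=> f0 g0 fi gi; have := coef_gt0M f g i 0 f0 g0 fi gi; rewrite addn0.
apply: (gt0M _ _); [ge0 | ge0 | | exact: geom_gt0_0].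
apply: (gt0M _ _); [ge0 | ge0 | | exact: geom_gt0_0].
by rewrite coef_qX eqxx.
Qed.

(** * Sign and zero set for every admissible x *)

Theorem theorem4 (L y x : nat) :
  (0 < L)%N -> (1 < y)%N -> odd y -> (1 < x)%N -> (x <= y + 2)%N ->
  (forall n : nat, (1 <= n)%N -> 0 <= acoef L y n x) /\
  (forall n : nat, (1 <= n)%N ->
     (acoef L y n x = 0 <->
      [\/ (n < x)%N /\ ~~ odd n,
          n = y /\ (y < x)%N
        | (L, y, n, x) = (1%N, 3%N, 9%N, 5%N)])).
Proof.
case: L => // L _ y_gt1 y_odd x_gt1 le_xy.
have [h y_eq] : exists h, y = (2 * h + 3)%N by exists ((y - 3) %/ 2)%N; lia.
have acoefE n : acoef L.+1 y n x = diff L.+1 y x n by [].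
have D0 : fle 0 (diff L.+1 y (y + 2)) by rewrite y_eq; exact: diff_ge0.
have Dx : fle (diff L.+1 y (y + 2)) (diff L.+1 y x).
  by apply: diff_anti; rewrite (ltnW x_gt1).
split=> n n_gt0; rewrite acoefE; first exact: le_trans (D0 n) (Dx n).
have step i : (x <= i)%N -> (i <= y + 1)%N ->
    0 < (q ^+ i * geom i * geom (i + 1)) n -> 0 < diff L.+1 y x n.
  move=> le_xi le_iy; apply: diff_gt0_step => //.
  by rewrite (ltnW x_gt1).
split=> [D_eq0 | zero_case].
  case: (EM [\/ (n < x)%N /\ ~~ odd n, n = y /\ (y < x)%N
        | (L.+1, y, n, x) = (1%N, 3%N, 9%N, 5%N)]) => // not_zero.
  suff : 0 < diff L.+1 y x n by rewrite D_eq0 ltxx.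
  case: (EM ((n < y + 2)%N /\ ~~ odd n)) => [[lt_ny n_even] | n_even].
    (* Excluding case (1) gives n >= x, and the increment from n to n + 1 gains q^n. *)
    apply: (step n); last exact: diff_step_gt0; last by lia.
    by rewrite leqNgt; apply/negP => lt_nx; apply: not_zero; constructor 1.
  case: (eqVneq n y) => [n_y | /eqP n_y].
    apply: (step n); last exact: diff_step_gt0; last by lia.
    rewrite leqNgt; apply/negP => lt_nx; apply: not_zero; constructor 2.
    by rewrite -n_y.
  case: (EM [/\ L = 0, h = 0 & n = 9]%N) => [[L0 h0 n9] | n9]; last first.
    by apply: lt_le_trans (Dx n); rewrite y_eq; apply: diff_gt0; rewrite -?y_eq.
  have y3 : y = 3%N by lia.
  (* Excluding case (3) leaves x <= 4, and the increment from 4 to 5 gains q^4 P_4 P_5, which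
     reaches 9 = 4 + 5. *)
  apply: (step 4%N); last 2 first.
  - by rewrite y3.
  - rewrite n9; apply: (coef_gt0M _ _ 4 5); [ge0 | ge0 | | by []].
    by apply: (coef_gt0M _ _ 4 0); [ge0 | ge0 | rewrite coef_qX |].
  rewrite leqNgt; apply/negP => lt_4x; apply: not_zero; constructor 3.
  by rewrite L0 y3 n9 (_ : x = 5%N) //; lia.
case: zero_case => [[lt_nx n_even] | [n_y lt_yx] | [L0 y3 n9 x5]].
- by apply: diff_zero => //; [lia | left].
- by apply: diff_zero => //; [rewrite n_y | lia | right].
by rewrite L0 y3 n9 x5; have := base_9; rewrite -diff_base.
Qed.
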